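(* Let $(S,\psi)$ be the final co-algebra of $F_3$ on $\mathbf{MS}_3^{S}$. Then $(S,\psi)$ is not the final co-algebra of $F_3$ on $\mathbf{MS}_3^{L}$.
   Context: A tri-pointed metric space is a set $X$ with three distinguished elements $T,L,R$ and a metric $d\le 1$ such that distinct distinguished elements are at distance $1$. $\mathbf{MS}_3^{S}$ and $\mathbf{MS}_3^{L}$ are the categories of tri-pointed metric spaces with, respectively, short maps (i.e. $1$-Lipschitz maps) and Lipschitz maps preserving the distinguished elements. Let $M_3=\{a,b,c\}$. $M_3\otimes X$ is the quotient of $M_3\times X$ by the equivalence relation generated by $(b,T)\sim(a,L)$, $(a,R)\sim(c,T)$, $(c,L)\sim(b,R)$, with distinguished elements $T=a\otimes T$, $L=b\otimes L$, $R=c\otimes R$; $m\otimes x$ is the class of $(m,x)$. It carries the metric $d(m\otimes x,m\otimes y)=\frac12 d(x,y)$, $d(a\otimes x,b\otimes y)=\frac12\min\{d(x,L)+d(T,y),\,d(x,R)+1+d(R,y)\}$, $d(a\otimes x,c\otimes y)=\frac12\min\{d(x,R)+d(T,y),\,d(x,L)+1+d(L,y)\}$, $d(b\otimes x,c\otimes y)=\frac12\min\{d(x,R)+d(L,y),\,d(x,T)+1+d(T,y)\}$. The endofunctor $F_3$ is $F_3X=M_3\otimes X$, $(F_3f)(m\otimes x)=(M_3\otimes f)(m\otimes x)=m\otimes f(x)$. An $F_3$ co-algebra is an object $X$ with a morphism $e:X\to M_3\otimes X$; a morphism $(X,e)\to(Y,e')$ is a morphism $f:X\to Y$ with $e'\circ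 f=(M_3\otimes f)\circ e$; a final co-algebra is a terminal object in the category of co-algebras. The co-algebra $(S,\psi)$: let $I=\{T,L,R\}$ with mutual distances $1$ (the initial object) and $!:I\to M_3\otimes I$ the unique morphism. $G$ is the colimit of the chain of isometric embeddings $I\to M_3\otimes I\to M_3^2\otimes I\to\cdots$ with maps $M_3^n\otimes !$, where $M_3^{n+1}\otimes I=M_3\otimes(M_3^n\otimes I)$; its elements are classes $[m_1\otimes\cdots\otimes m_k\otimes d]$ with $m_j\in M_3$, $d\in I$. The map $g:M_3\otimes G\to G$, $g(m\otimes[x])=[m\otimes x]$, is an isometric bijection. $S$ is the Cauchy completion of $G$ and $\psi:S\to M_3\otimes S$ is the continuous extension of $g^{-1}$. It is known that $(S,\psi)$ is the final co-algebra of $F_3$ on $\mathbf{MS}_3^{S}$ and, after forgetting the metric, on the category of tri-pointed sets. *)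

(* Defs.v *)
From HB Require Import structures.
From Stdlib Require Import Relation_Operators.
From mathcomp Require Import all_boot all_order all_algebra.
From mathcomp Require Import generic_quotient.
From mathcomp Require Import boolp classical_sets reals topology.
From mathcomp Require Import lra.

Set Implicit Arguments.
Unset Strict Implicit.
Unset Printing Implicit Defensive.

Import Order.TTheory GRing.Theory Num.Theory.

Local Open Scope ring_scope.
Local Open Scope quotient_scope.

Record category := Category {
  obj :> Type;
  hom : obj -> obj -> Type;
  idm : forall X, hom X X;
  comp : forall X Y Z, hom Y Z -> hom X Y -> hom X Z;
  comp1m : forall X Y (f : hom X Y), comp (idm Y) f = f;
  compm1 : forall X Y (f : hom X Y), comp f (idm X) = f;
  compA : forall W X Y Z (h : hom Y Z) (g : hom X Y) (f : hom W X),
    comp h (comp g f) = comp (comp h g) f }.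

Arguments hom {c}.
Arguments idm {c}.
Arguments comp {c X Y Z}.

Record endofunctor (C : category) := Endofunctor {
  fobj :> C -> C;
  fmap : forall X Y : C, hom X Y -> hom (fobj X) (fobj Y);
  fmap1 : forall X : C, fmap (idm X) = idm (fobj X);
  fmapM : forall (X Y Z : C) (g : hom Y Z) (f : hom X Y),
    fmap (comp g f) = comp (fmap g) (fmap f) }.

Arguments fmap {C} e {X Y}.

Definition terminal (C : category) (Z : C) : Prop :=
  forall X : C, exists f : hom X Z, forall g : hom X Z, g = f.

Section Coalgebra.
Variables (C : category) (F : endofunctor C).

Record coalgebra := Coalgebra {
  carrier : C;
  structure_map : hom carrier (F carrier) }.

Implicit Types X Y Z : coalgebra.

Definition coalgebra_hom X Y : Type :=
  {f : hom (carrier X) (carrier Y) |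
    comp (structure_map Y) f = comp (fmap F f) (structure_map X)}.

Lemma coalgebra_hom_eq X Y (f g : coalgebra_hom X Y) : sval f = sval g -> f = g.
Proof. by case: f g => [f fP] [g gP] /= fg; exact: eq_exist. Qed.

Definition coalgebra_id X : coalgebra_hom X X.
Proof. by exists (idm _); rewrite fmap1 compm1 comp1m. Defined.

Definition coalgebra_comp X Y Z (g : coalgebra_hom Y Z) (f : coalgebra_hom X Y) :
  coalgebra_hom X Z.
Proof.
exists (comp (sval g) (sval f)).
by rewrite compA (svalP g) -compA (svalP f) compA -fmapM.
Defined.

Definition coalgebra_category : category.
Proof.
apply: (@Category coalgebra coalgebra_hom coalgebra_id coalgebra_comp).
- by move=> X Y f; apply: coalgebra_hom_eq; rewrite /= comp1m.
- by move=> X Y f; apply: coalgebra_hom_eq; rewrite /= compm1.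
- by move=> W X Y Z h g f; apply: coalgebra_hom_eq; rewrite /= compA.
Defined.

Definition final_coalgebra (Z : coalgebra) : Prop :=
  @terminal coalgebra_category Z.

End Coalgebra.

HB.mixin Record Metric_isTriPointed (R : realType) X & Metric R X := {
  ptT : X;
  ptL : X;
  ptR : X;
  mdist_le1 : forall x y : X, mdist x y <= 1;
  mdistTL : mdist ptT ptL = 1;
  mdistTR : mdist ptT ptR = 1;
  mdistLR : mdist ptL ptR = 1 }.

#[short(type="triMetricType")]
HB.structure Definition TriMetric (R : realType) :=
  { X of Metric R X & Metric_isTriPointed R X }.

Section Maps.
Context {R : realType}.
Implicit Types X Y : triMetricType R.

Definition preserves_points X Y (f : X -> Y) : Prop :=
  [/\ f ptT = ptT, f ptL = ptL & f ptR = ptR].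

Definition short_map X Y (f : X -> Y) : Prop :=
  forall x y, mdist (f x) (f y) <= mdist x y.

Definition lipschitz_map X Y (f : X -> Y) : Prop :=
  exists k : R, forall x y, mdist (f x) (f y) <= k * mdist x y.

End Maps.

Variant M3 := Ma | Mb | Mc.

HB.instance Definition _ := gen_eqMixin M3.
HB.instance Definition _ := gen_choiceMixin M3.

Section Tensor.
Context {R : realType} (X : triMetricType R).
Implicit Types (p q : M3 * X) (x y : X).

Variant glue_step : M3 * X -> M3 * X -> Prop :=
  | glue_ba : glue_step (Mb, ptT) (Ma, ptL)
  | glue_ac : glue_step (Ma, ptR) (Mc, ptT)
  | glue_cb : glue_step (Mc, ptL) (Mb, ptR).

Definition glue p q : bool := `[< clos_refl_sym_trans _ glue_step p q >].

Lemma glue_refl : reflexive glue.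
Proof. by move=> p; apply/asboolP; exact: rst_refl. Qed.

Lemma glue_sym : symmetric glue.
Proof. by move=> p q; apply/asboolP/asboolP; exact: rst_sym. Qed.

Lemma glue_trans : transitive glue.
Proof. by move=> q p r /asboolP pq /asboolP qr; apply/asboolP; exact: rst_trans qr. Qed.

Canonical glue_equiv := EquivRel glue glue_refl glue_sym glue_trans.

Definition tensor := {eq_quot glue_equiv}.

HB.instance Definition _ := Choice.on tensor.
HB.instance Definition _ := Quotient.on tensor.

Definition tens (m : M3) (x : X) : tensor := \pi_tensor (m, x).

Local Notation d := (@mdist R X).

Definition dist_ab x y : R :=
  2^-1 * Num.min (d x ptL + d ptT y) (d x ptR + 1 + d ptR y).
Definition dist_ac x y : R :=
  2^-1 * Num.min (d x ptR + d ptT y) (d x ptL + 1 + d ptL y).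
Definition dist_bc x y : R :=
  2^-1 * Num.min (d x ptR + d ptL y) (d x ptT + 1 + d ptT y).

Definition pair_dist p q : R :=
  let: (m, x) := p in let: (n, y) := q in
  match m, n with
  | Ma, Ma | Mb, Mb | Mc, Mc => 2^-1 * d x y
  | Ma, Mb => dist_ab x y | Mb, Ma => dist_ab y x
  | Ma, Mc => dist_ac x y | Mc, Ma => dist_ac y x
  | Mb, Mc => dist_bc x y | Mc, Mb => dist_bc y x
  end.

(* Independent of the choice of representatives, see [mdist_tens]. *)
Definition tensor_dist (u v : tensor) : R := pair_dist (repr u) (repr v).

Lemma pair_distxx p : pair_dist p p = 0.
Proof. by case: p => -[] x /=; rewrite mdistxx mulr0. Qed.

Lemma pair_distC p q : pair_dist p q = pair_dist q p.
Proof. by case: p q => [[] x] [[] y] //=; rewrite metric_sym. Qed.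

Let dTL : d ptT ptL = 1. Proof. exact: mdistTL. Qed.
Let dTR : d ptT ptR = 1. Proof. exact: mdistTR. Qed.
Let dLR : d ptL ptR = 1. Proof. exact: mdistLR. Qed.
Let dLT : d ptL ptT = 1. Proof. by rewrite metric_sym. Qed.
Let dRT : d ptR ptT = 1. Proof. by rewrite metric_sym. Qed.
Let dRL : d ptR ptL = 1. Proof. by rewrite metric_sym. Qed.

Let min_le (u v : R) :
  Num.min u v <= u /\ Num.min u v <= v /\ (Num.min u v = u \/ Num.min u v = v).
Proof. by case: (lerP u v) => ?; split; [lra | split; [lra | tauto] | lra | split; [lra | tauto]]. Qed.

Let corner (m : M3) : X := match m with Ma => ptT | Mb => ptL | Mc => ptR end.

Let third (m n : M3) : M3 :=
  match m, n with
  | Ma, Mb | Mb, Ma => Mc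
  | Ma, Mc | Mc, Ma => Mb
  | _, _ => Ma
  end.

Let far m n x y : R :=
  2^-1 * Num.min (d x (corner n) + d y (corner m))
                 (d x (corner (third m n)) + 1 + d y (corner (third m n))).

Let pair_distE m n x y :
  pair_dist (m, x) (n, y) = if m == n then 2^-1 * d x y else far m n x y.
Proof.
have sy z w : d z w = d w z by exact: metric_sym.
have E k l : (k == l) =
    match k, l with Ma, Ma | Mb, Mb | Mc, Mc => true | _, _ => false end.
  by apply/eqP/idP; case: k l => [] [].
by rewrite E; case: m n => [] [] //=; rewrite /dist_ab /dist_ac /dist_bc /far /=;
  congr (_ * Num.min _ _); rewrite ?(sy ptT) ?(sy ptL) ?(sy ptR); lra.
Qed.

Let d01 x y : 0 <= d x y <= 1. Proof. by rewrite mdist_ge0 mdist_le1. Qed.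

Let corner_dist m n : m != n -> d (corner m) (corner n) = 1.
Proof. by case: m n => [] []; rewrite ?eqxx //= => _. Qed.

Let thirdE m n k : m != n -> n != k -> m != k -> third m n = k.
Proof. by case: m n k => [] [] []; rewrite ?eqxx. Qed.

Let far_sym m n x y : far m n x y = far n m y x.
Proof.
have -> : far n m y x = 2^-1 * Num.min (d y (corner m) + d x (corner n))
    (d y (corner (third m n)) + 1 + d x (corner (third m n))).
  by rewrite /far; case: m n => [] [].
by rewrite /far; congr (_ * Num.min _ _); lra.
Qed.

Lemma pair_dist_triangle q p r :
  pair_dist p r <= pair_dist p q + pair_dist q r.
Proof.
have tri x y z : d x z <= d x y + d y z by exact: metric_triangle.
have aux m n k x y z : m = n -> n != k -> far m k x z <= 2^-1 * d x y + far n k y z.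
  move=> -> nk; rewrite /far.
  have [? [? ?]] := min_le (d x (corner k) + d z (corner n))
     (d x (corner (third n k)) + 1 + d z (corner (third n k))).
  have [_ [_ [->|->]]] := min_le (d y (corner k) + d z (corner n))
     (d y (corner (third n k)) + 1 + d z (corner (third n k))).
  - by have := tri x y (corner k); lra.
  - by have := tri x y (corner (third n k)); lra.
case: p q r => [m x] [n y] [k z]; rewrite !pair_distE.
case: (eqVneq m n) => [mn|mn]; case: (eqVneq n k) => [nk|nk].
- by rewrite mn nk eqxx; have := tri x y z; lra.
- by rewrite mn (negbTE nk); exact: aux.
- rewrite -nk (negbTE mn) addrC (metric_sym y z) !(far_sym m); apply: aux => //.
  by rewrite eq_sym.
case: (eqVneq m k) => [mk|mk].
  rewrite -mk /far; have := tri x (corner n) z; have /andP[_ ?] := d01 x z.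
  rewrite (metric_sym (corner n)).
  have pos w l : 0 <= d w (corner l) by case/andP: (d01 w (corner l)).
  have := (pos x n, pos x (third m n), pos y m, pos y (third m n), pos z n, pos z (third m n), pos y (third n m), pos z (third n m)).
  move=> [[[[[[[? ?] ?] ?] ?] ?] ?] ?] ?.
  have [_ [_ [->|->]]] := min_le (d x (corner n) + d y (corner m))
    (d x (corner (third m n)) + 1 + d y (corner (third m n)));
  have [_ [_ [->|->]]] := min_le (d y (corner m) + d z (corner n))
    (d y (corner (third n m)) + 1 + d z (corner (third n m))); lra.
have [nm km kn] : [/\ n != m, k != m & k != n] by rewrite !(eq_sym k) (eq_sym n).
rewrite /far (thirdE mn nk mk) (thirdE nk km nm) (thirdE mk kn mn).
have := tri (corner m) y (corner k).
rewrite (corner_dist mk) (metric_sym (corner m)).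
have /andP[? ?] := d01 x (corner n); have /andP[? ?] := d01 x (corner k).
have /andP[? ?] := d01 y (corner m); have /andP[? ?] := d01 y (corner k).
have /andP[? ?] := d01 z (corner m); have /andP[? ?] := d01 z (corner n).
have [? [? _]] := min_le (d x (corner k) + d z (corner m))
    (d x (corner n) + 1 + d z (corner n)).
have [_ [_ [->|->]]] := min_le (d x (corner n) + d y (corner m))
    (d x (corner k) + 1 + d y (corner k));
have [_ [_ [->|->]]] := min_le (d y (corner k) + d z (corner n))
    (d y (corner m) + 1 + d z (corner m)); lra.
Qed.

Lemma pair_dist0P p q : reflect (pair_dist p q = 0) (glue p q).
Proof.
have d_ge0 x y : 0 <= d x y by exact: mdist_ge0.
apply: (iffP (asboolP _)) => [|].
  have ge0 p' q' : 0 <= pair_dist p' q'.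
    have := pair_dist_triangle q' p' p'.
    by rewrite pair_distxx (pair_distC q'); lra.
  elim=> [_ _ []|?|p' q' _ pq0|p' q' r _ pq0 _ qr0].
  - rewrite /= /dist_ab !mdistxx dLR dRT; case: lerP => ?; lra.
  - rewrite /= /dist_ac !mdistxx dRL dLT; case: lerP => ?; lra.
  - rewrite /= /dist_bc !mdistxx dRT dTL; case: lerP => ?; lra.
  - exact: pair_distxx.
  - by rewrite pair_distC.
  - by have := pair_dist_triangle q' p' r; have := ge0 p' r; lra.
have half0 (t : R) : 2^-1 * t = 0 -> t = 0 by move=> ?; lra.
have min0 x1 x2 y1 y2 z1 z2 w1 w2 :
    2^-1 * Num.min (d x1 x2 + d y1 y2) (d z1 z2 + 1 + d w1 w2) = 0 ->
    x1 = x2 /\ y1 = y2.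
  move/half0; have := (d_ge0 x1 x2, d_ge0 y1 y2, d_ge0 z1 z2, d_ge0 w1 w2).
  move=> [[[? ?] ?] ?]; case: lerP => ? ?; last by exfalso; lra.
  by split; apply: (@mdist_positivity R); lra.
case: p q => [m x] [n y]; case: m n => [] [] /=;
  rewrite /dist_ab /dist_ac /dist_bc;
  try (by move/half0/mdist_positivity => ->; exact: rst_refl);
  move/min0 => [-> <-] || move/min0 => [<- ->];
  by [apply: rst_step; constructor | apply: rst_sym; apply: rst_step; constructor].
Qed.

Lemma tens_surj (u : tensor) : exists m x, u = tens m x.
Proof. by exists (repr u).1, (repr u).2; rewrite /tens -surjective_pairing reprK. Qed.

Lemma tens_eqP m x n y :
  reflect (tens m x = tens n y) (glue (m, x) (n, y)).
Proof. by rewrite /tens -[glue _ _]/(glue_equiv _ _) -eqmodE; exact: eqP. Qed.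

Lemma tensor_distE m x n y :
  tensor_dist (tens m x) (tens n y) = pair_dist (m, x) (n, y).
Proof.
have rep k z : pair_dist (k, z) (repr (tens k z)) = 0.
  apply/pair_dist0P; case E : (repr (tens k z)) => [l w]; apply/tens_eqP.
  by rewrite [RHS]/tens -E reprK.
rewrite /tensor_dist; apply/eqP; rewrite eq_le; apply/andP; split.
- have := pair_dist_triangle (m, x) (repr (tens m x)) (repr (tens n y)).
  have := pair_dist_triangle (n, y) (m, x) (repr (tens n y)).
  by rewrite (pair_distC (repr (tens m x)) (m, x)) !rep; lra.
- have := pair_dist_triangle (repr (tens m x)) (m, x) (n, y).
  have := pair_dist_triangle (repr (tens n y)) (repr (tens m x)) (n, y).
  by rewrite (pair_distC (repr (tens n y)) (n, y)) !rep; lra.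
Qed.

Lemma tensor_dist_positivity (u v : tensor) : tensor_dist u v = 0 -> u = v.
Proof.
have [m [x ->]] := tens_surj u; have [n [y ->]] := tens_surj v.
by rewrite tensor_distE => /pair_dist0P/tens_eqP.
Qed.

HB.instance Definition _ := @isMetric.Build R tensor tensor_dist
  (fun u => pair_distxx (repr u)) tensor_dist_positivity
  (fun u v => pair_distC (repr u) (repr v))
  (fun v u w => pair_dist_triangle (repr v) (repr u) (repr w)).

Lemma mdist_tens m x n y :
  mdist (tens m x) (tens n y) = pair_dist (m, x) (n, y).
Proof. exact: tensor_distE. Qed.

Let tensor_mdist_le1 (u v : tensor) : mdist u v <= 1.
Proof.
have [m [x ->]] := tens_surj u; have [n [y ->]] := tens_surj v.
rewrite mdist_tens pair_distE /far; case: eqP => _.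
  by have /andP[_ ?] := d01 x y; lra.
have [? _] := min_le (d x (corner n) + d y (corner m))
  (d x (corner (third m n)) + 1 + d y (corner (third m n))).
have /andP[_ ?] := d01 x (corner n); have /andP[_ ?] := d01 y (corner m).
by lra.
Qed.

Let tensor_distTL : mdist (tens Ma ptT) (tens Mb ptL) = 1.
Proof. by rewrite mdist_tens /= /dist_ab dTL dTR dRL; case: lerP => ?; lra. Qed.

Let tensor_distTR : mdist (tens Ma ptT) (tens Mc ptR) = 1.
Proof. by rewrite mdist_tens /= /dist_ac dTL dTR dLR; case: lerP => ?; lra. Qed.

Let tensor_distLR : mdist (tens Mb ptL) (tens Mc ptR) = 1.
Proof. by rewrite mdist_tens /= /dist_bc dLT dLR dTR; case: lerP => ?; lra. Qed.

HB.instance Definition _ := @Metric_isTriPointed.Build R tensor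
  (tens Ma ptT) (tens Mb ptL) (tens Mc ptR)
  tensor_mdist_le1 tensor_distTL tensor_distTR tensor_distLR.

End Tensor.

(* When [f] preserves the distinguished points this does not depend on the
   choice of representatives, see [tensor_mapE]. *)
Definition tensor_map {R : realType} (X Y : triMetricType R) (f : X -> Y)
  (u : tensor X) : tensor Y := tens (repr u).1 (f (repr u).2).

Section TensorMap.
Context {R : realType}.
Implicit Types X Y Z : triMetricType R.

Lemma tensor_mapE X Y (f : X -> Y) m x :
  preserves_points f -> tensor_map f (tens m x) = tens m (f x).
Proof.
move=> [fT fL fR].
have F (p q : M3 * X) : clos_refl_sym_trans _ (@glue_step R X) p q ->
    tens p.1 (f p.2) = tens q.1 (f q.2).
  elim=> [_ _ []|//|p' q' _ ->//|p' q' r _ -> _ ->//] /=;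
    rewrite ?(fT, fL, fR); apply/tens_eqP/asboolP; apply: rst_step; constructor.
rewrite /tensor_map; apply: (F (repr (tens m x)) (m, x)); apply/asboolP.
case E : (repr (tens m x)) => [n y]; apply/tens_eqP.
by rewrite [LHS]/tens -E reprK.
Qed.

Lemma tensor_map_preserves X Y (f : X -> Y) :
  preserves_points f -> preserves_points (tensor_map f).
Proof.
move=> fP; have [fT fL fR] := fP; split.
- exact: etrans (tensor_mapE Ma ptT fP) (congr1 (tens Ma) fT).
- exact: etrans (tensor_mapE Mb ptL fP) (congr1 (tens Mb) fL).
- exact: etrans (tensor_mapE Mc ptR fP) (congr1 (tens Mc) fR).
Qed.

Lemma tensor_map_le (k : R) X Y (f : X -> Y) : 1 <= k -> preserves_points f ->
  (forall x y, mdist (f x) (f y) <= k * mdist x y) ->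
  forall u v, mdist (tensor_map f u) (tensor_map f v) <= k * mdist u v.
Proof.
move=> k1 fP fk u v; have [fT fL fR] := fP.
have [m [x ->]] := tens_surj u; have [n [y ->]] := tens_surj v.
rewrite !tensor_mapE // !mdist_tens.
have aux (A B A' B' C C' D D' : R) : A <= k * A' -> B <= k * B' ->
    C <= k * C' -> D <= k * D' ->
    2^-1 * Num.min (A + B) (C + 1 + D) <=
    k * (2^-1 * Num.min (A' + B') (C' + 1 + D')).
  move=> AA BB CC DD; rewrite mulrCA ler_pM2l ?invr_gt0//.
  case: (lerP (A' + B')) => ?; rewrite ge_min; apply/orP.
  - by left; lra.
  - by right; lra.
have aux1 (A A' : R) : A <= k * A' -> 2^-1 * A <= k * (2^-1 * A').
  by move=> AA; rewrite mulrCA ler_pM2l ?invr_gt0.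
have hT z : mdist (f z) ptT <= k * mdist z ptT by rewrite -fT.
have hL z : mdist (f z) ptL <= k * mdist z ptL by rewrite -fL.
have hR z : mdist (f z) ptR <= k * mdist z ptR by rewrite -fR.
have hT' z : mdist ptT (f z) <= k * mdist ptT z by rewrite -fT.
have hL' z : mdist ptL (f z) <= k * mdist ptL z by rewrite -fL.
have hR' z : mdist ptR (f z) <= k * mdist ptR z by rewrite -fR.
by case: m n => [] [] /=; first [exact: aux1 | exact: aux].
Qed.

Lemma tensor_map_id X : tensor_map (@id X) = id.
Proof.
apply/funext => u; have [m [x ->]] := tens_surj u.
by rewrite tensor_mapE.
Qed.

Lemma tensor_map_comp X Y Z (g : Y -> Z) (f : X -> Y) :
  preserves_points g -> preserves_points f ->
  tensor_map (g \o f) = tensor_map g \o tensor_map f.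
Proof.
move=> gP fP; apply/funext => u; have [m [x ->]] := tens_surj u.
rewrite /= !tensor_mapE //; case: gP fP => gT gL gR [fT fL fR].
by split; rewrite /= ?(fT, fL, fR).
Qed.

End TensorMap.

(* A class of maps closed under identities, composition and the tensor, so
   that the short and the Lipschitz categories are instances of one
   construction. *)
Record map_class (R : realType) := MapClass {
  in_class : forall X Y : triMetricType R, (X -> Y) -> Prop;
  in_class_id : forall X : triMetricType R, in_class (@id X);
  in_class_comp : forall (X Y Z : triMetricType R) (g : Y -> Z) (f : X -> Y),
    in_class g -> in_class f -> in_class (g \o f);
  in_class_tensor : forall (X Y : triMetricType R) (f : X -> Y),
    preserves_points f -> in_class f -> in_class (tensor_map f) }.

Definition short_class (R : realType) : map_class R.
Proof.
apply: (@MapClass R (@short_map R)).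
- by move=> X x y.
- by move=> X Y Z g f gs fs x y; exact: le_trans (gs _ _) (fs _ _).
- move=> X Y f fP fs u v; rewrite -[leRHS]mul1r.
  by apply: tensor_map_le => // x y; rewrite mul1r.
Defined.

Lemma lipschitz_ge1 (R : realType) (X Y : triMetricType R) (f : X -> Y) :
  lipschitz_map f ->
  exists2 k : R, 1 <= k & forall x y, mdist (f x) (f y) <= k * mdist x y.
Proof.
move=> [k fk]; exists (Num.max 1 k) => [|x y]; first by rewrite le_max lexx.
apply: le_trans (fk x y) _; apply: ler_wpM2r; first exact: mdist_ge0.
by rewrite le_max lexx orbT.
Qed.

Definition lipschitz_class (R : realType) : map_class R.
Proof.
apply: (@MapClass R (@lipschitz_map R)).
- by move=> X; exists 1 => x y; rewrite mul1r.
- move=> X Y Z g f /lipschitz_ge1[k k1 gk] [l fl]; exists (k * l) => x y.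
  apply: le_trans (gk _ _) _; rewrite -mulrA; apply: ler_wpM2l (fl x y).
  exact: le_trans k1.
- move=> X Y f fP /lipschitz_ge1[k k1 fk]; exists k; exact: tensor_map_le.
Defined.

Section MS3.
Context {R : realType} (K : map_class R).
Implicit Types X Y Z : triMetricType R.

Definition MS3_hom X Y : Type := {f : X -> Y | preserves_points f /\ in_class K f}.

Lemma MS3_hom_eq X Y (f g : MS3_hom X Y) : sval f = sval g -> f = g.
Proof. by case: f g => [f fP] [g gP] /= fg; exact: eq_exist. Qed.

Definition MS3_id X : MS3_hom X X.
Proof. by exists id; split; [split | exact: in_class_id]. Defined.

Definition MS3_comp X Y Z (g : MS3_hom Y Z) (f : MS3_hom X Y) : MS3_hom X Z.
Proof.
exists (sval g \o sval f); case: g f => [g [[gT gL gR] gK]] [f [[fT fL fR] fK]].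
by split; [split; rewrite /= ?(fT, fL, fR) | exact: in_class_comp].
Defined.

Definition MS3 : category.
Proof.
by apply: (@Category (triMetricType R) MS3_hom MS3_id MS3_comp) => *;
  exact: MS3_hom_eq.
Defined.

Definition F3_map X Y (f : MS3_hom X Y) : MS3_hom (tensor X) (tensor Y).
Proof.
exists (tensor_map (sval f)); case: f => f [fP fK].
by split; [exact: tensor_map_preserves | exact: in_class_tensor].
Defined.

Definition F3 : endofunctor MS3.
Proof.
apply: (@Endofunctor MS3 (fun X : triMetricType R => tensor X) F3_map).
- by move=> X; apply: MS3_hom_eq; exact: tensor_map_id.
- move=> X Y Z [g [gP gK]] [f [fP fK]]; apply: MS3_hom_eq.
  exact: tensor_map_comp.
Defined.

End MS3.

Definition MS3S (R : realType) : category := MS3 (short_class R).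
Definition MS3L (R : realType) : category := MS3 (lipschitz_class R).
Definition F3S (R : realType) : endofunctor (MS3S R) := F3 (short_class R).
Definition F3L (R : realType) : endofunctor (MS3L R) := F3 (lipschitz_class R).

Lemma short_lipschitz (R : realType) (X Y : triMetricType R) (f : X -> Y) :
  short_map f -> lipschitz_map f.
Proof. by move=> fs; exists 1 => x y; rewrite mul1r. Qed.

Definition lipschitz_of_short (R : realType) (X Y : MS3S R) (f : hom X Y) :
  @hom (MS3L R) X Y.
Proof.
exists (sval f); case: f => f [fP fs].
by split; last exact: short_lipschitz.
Defined.

Definition lipschitz_coalgebra (R : realType) (C : coalgebra (F3S R)) :
  coalgebra (F3L R) :=
  @Coalgebra (MS3L R) (F3L R) (carrier C)
    (lipschitz_of_short (structure_map C)).

(* Main.v *)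
Require Import Defs.
From HB Require Import structures.
From mathcomp Require Import all_boot all_order all_algebra.
From mathcomp Require Import boolp reals topology.
From mathcomp Require Import lra.

(** The reason is that the final short coalgebra has a short structure map, and
no coalgebra with a short structure map is final among Lipschitz coalgebras.
Tensoring with [a] halves distances. An orbit that always passes through [a]
can therefore double, at each step, its distance to the orbit of [T] under a
short structure map, but no more. A Lipschitz structure map allows any fixed
growth rate.

The witness is a sequence [y_0 = L, y_1, y_2, ...] with [d(T, y_n) = 4^-n],
together with [T] and a remote point [R], and the dynamics
[y_(n+1) |-> a (x) y_n] and [T |-> a (x) T]. These multiply distances by
[4 / 2 = 2] near [T], and are Lipschitz ([spoke_unfold_lipschitz]). Let [f] be
a morphism from the witness to a coalgebra with short structure map [psi].
Then [psi (f y_(n+1)) = a (x) f y_n] and [psi (f T) = a (x) f T], so that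
[d(f T, f y_(n+1)) >= d(f T, f y_n) / 2], hence [d(f T, f y_n) >= 2^-n]
([morphism_expands]). A Lipschitz constant [k] of [f] would satisfy
[2^-n <= k * 4^-n], that is [2^n <= k], for all [n]. *)

Set Implicit Arguments.
Unset Strict Implicit.
Unset Printing Implicit Defensive.

Import Order.TTheory GRing.Theory Num.Theory.

Local Open Scope ring_scope.

(** Here [spoke_tip] is [T], [spoke_far] is [R] and [spoke_pt n] is the point
[y_n] of the sequence converging to [T], with [y_0] the point [L]. *)
Variant spoke := spoke_tip | spoke_far | spoke_pt of nat.

HB.instance Definition _ := gen_eqMixin spoke.
HB.instance Definition _ := gen_choiceMixin spoke.

Section Spoke.
Context {R : realType}.
Implicit Types u v w : spoke.

Definition spoke_pos u : R := if u is spoke_pt n then 4^-1 ^+ n else 0.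

Definition spoke_dist u v : R :=
  match u, v with
  | spoke_far, spoke_far => 0
  | spoke_far, _ | _, spoke_far => 1
  | _, _ => `|spoke_pos u - spoke_pos v|
  end.

Lemma spoke_pos01 u : 0 <= spoke_pos u <= 1.
Proof.
by case: u => [||n] /=; rewrite ?lexx ?ler01 // exprn_ge0 ?exprn_ile1 //; lra.
Qed.

Lemma spoke_pos_pt_gt0 n : 0 < spoke_pos (spoke_pt n).
Proof. by rewrite /= exprn_gt0 // invr_gt0 ltr0n. Qed.

Lemma spoke_pos_ptS n : spoke_pos (spoke_pt n) = 4 * spoke_pos (spoke_pt n.+1).
Proof. by rewrite /= exprS; lra. Qed.

Lemma spoke_distxx u : spoke_dist u u = 0.
Proof. by case: u => [||n] //=; rewrite subrr normr0. Qed.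

Lemma spoke_distC u v : spoke_dist u v = spoke_dist v u.
Proof. by case: u v => [||n] [||m] //=; rewrite distrC. Qed.

Lemma spoke_dist_positivity u v : spoke_dist u v = 0 -> u = v.
Proof.
case: u v => [||n] [||m] //= /eqP;
  rewrite ?oner_eq0 // normr_eq0 subr_eq0 => /eqP dist0.
- by have := spoke_pos_pt_gt0 m; rewrite /= -dist0 ltxx.
- by have := spoke_pos_pt_gt0 n; rewrite /= dist0 ltxx.
by congr spoke_pt; apply: (ieexprIn _ _ dist0); lra.
Qed.

Lemma spoke_dist_triangle v u w :
  spoke_dist u w <= spoke_dist u v + spoke_dist v w.
Proof.
have tri (x y z : R) : `|x - z| <= `|x - y| + `|y - z| by exact: ler_distD.
have near (x y : R) : 0 <= x <= 1 -> 0 <= y <= 1 -> `|x - y| <= 1 + 1.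
  by move=> /andP[? ?] /andP[? ?]; rewrite ler_norml; lra.
case: u v w => [||n] [||m] [||k]; rewrite /spoke_dist ?tri //;
  by rewrite ?near ?spoke_pos01 ?addr0 ?add0r ?lerDr ?lerDl ?addr_ge0.
Qed.

HB.instance Definition _ := @isMetric.Build R spoke spoke_dist
  spoke_distxx spoke_dist_positivity spoke_distC spoke_dist_triangle.


Lemma spoke_distE u v : mdist u v = spoke_dist u v.
Proof. by []. Qed.

Lemma spoke_dist_le1 u v : mdist u v <= 1.
Proof.
rewrite spoke_distE; have := (spoke_pos01 u, spoke_pos01 v).
by case: u v => [||n] [||m]; rewrite /spoke_dist => -[/andP[? ?] /andP[? ?]];
  rewrite ?ler_norml; lra.
Qed.

Lemma spoke_dist_tip_pt n : mdist spoke_tip (spoke_pt n) = 4^-1 ^+ n.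
Proof.
by rewrite spoke_distE /= sub0r normrN ger0_norm // ltW // spoke_pos_pt_gt0.
Qed.

Lemma spoke_dist_tip_pt0 : mdist spoke_tip (spoke_pt 0) = 1.
Proof. by rewrite spoke_dist_tip_pt. Qed.

HB.instance Definition _ := @Metric_isTriPointed.Build R spoke
  spoke_tip (spoke_pt 0) spoke_far
  spoke_dist_le1 spoke_dist_tip_pt0 erefl erefl.

Definition spoke_unfold u : tensor (spoke : triMetricType R) :=
  match u with
  | spoke_tip => tens Ma (spoke_tip : (spoke : triMetricType R))
  | spoke_far => tens Mc (spoke_far : (spoke : triMetricType R))
  | spoke_pt 0 => tens Mb (spoke_pt 0 : (spoke : triMetricType R))
  | spoke_pt n.+1 => tens Ma (spoke_pt n : (spoke : triMetricType R))
  end.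

Lemma spoke_unfold_preserves : preserves_points spoke_unfold.
Proof. by []. Qed.

(** Away from [y_0] and [R], the map is the shift by one index, which multiplies
distances by [4], followed by the copy [a], which halves them. If one of two
distinct points is [y_0] or [R], their distance is at least [3/4] and the
bound [1] on all distances suffices. *)
Lemma spoke_unfold_lipschitz u v :
  mdist (spoke_unfold u) (spoke_unfold v) <= 2 * mdist u v.
Proof.
have [->|/eqP uv] := eqVneq u v; first by rewrite !mdistxx mulr0.
have shift n := spoke_pos_ptS n.
have tip_fix : spoke_pos spoke_tip = 4 * spoke_pos spoke_tip.
  by rewrite mulr0.
have apart : 2^-1 <= mdist u v :> R ->
    mdist (spoke_unfold u) (spoke_unfold v) <= 2 * mdist u v.
  by have := mdist_le1 (spoke_unfold u) (spoke_unfold v); lra.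
have near (x y x' y' : R) : x' = 4 * x -> y' = 4 * y ->
    2^-1 * `|x' - y'| <= 2 * `|x - y|.
  by move=> -> ->; rewrite -mulrBr normrM ger0_norm //; lra.
have pt0_pt n : 2^-1 <= `|spoke_pos (spoke_pt 0) - spoke_pos (spoke_pt n.+1)|.
  apply: le_trans (ler_norm _); rewrite [spoke_pos (spoke_pt 0)]expr0.
  by have /andP[_] := spoke_pos01 (spoke_pt n); rewrite shift; lra.
case: u v uv apart => [||[|n]] [||[|m]] uv apart //;
  try (by apply: apart; rewrite spoke_distE /spoke_dist //; lra).
- by apply: apart; rewrite spoke_dist_tip_pt0; lra.
- rewrite mdist_tens; exact: near tip_fix (shift m).
- by apply: apart; rewrite metric_sym spoke_dist_tip_pt0; lra.
- rewrite mdist_tens; exact: near (shift n) tip_fix.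
- by apply: apart; rewrite metric_sym; exact: pt0_pt.
- rewrite mdist_tens; exact: near (shift n) (shift m).
Qed.

End Spoke.

(** As [T] is sent to [a (x) T] and [y_(n+1)] to [a (x) y_n], the images of [T]
and [y_n] under [f], halved by the copy [a], are the images under [psi] of those
of [T] and [y_(n+1)]; and [psi] does not increase distances. *)
Lemma morphism_expands (R : realType) (X : triMetricType R)
    (psi : X -> tensor X) (f : (spoke : triMetricType R) -> X) :
  short_map psi -> preserves_points f ->
  psi \o f = tensor_map f \o spoke_unfold ->
  forall n, 2^-1 ^+ n <= mdist (f spoke_tip) (f (spoke_pt n)).
Proof.
move=> psi_short fP fpsi.
have psiE u : psi (f u) = tensor_map f (spoke_unfold u).
  exact: (congr1 (fun h => h u) fpsi).
elim=> [|n IHn]; first by case: fP => -> -> _; rewrite expr0 mdistTL.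
apply: le_trans (psi_short _ _); rewrite !psiE /= !tensor_mapE // mdist_tens /=.
by rewrite exprS ler_pM2l // invr_gt0.
Qed.

Definition spoke_coalgebra (R : realType) : coalgebra (F3L R) :=
  @Coalgebra (MS3L R) (F3L R) (spoke : triMetricType R)
    (exist _ (@spoke_unfold R)
      (conj spoke_unfold_preserves (ex_intro _ 2 spoke_unfold_lipschitz))).

Theorem proposition6 (R : realType) (S : coalgebra (F3S R)) :
  final_coalgebra S -> ~ final_coalgebra (lipschitz_coalgebra S).
Proof.
move=> _ /(_ (spoke_coalgebra R)) [[[f [fP [k f_lip]]] /= fpsi] _].
case: S f fP f_lip fpsi => X [psi [psiP psi_short]] /= f fP f_lip fpsi.
have expands := morphism_expands psi_short fP (congr1 sval fpsi).
have pow2_le n : 2 ^+ n <= k.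
  have := le_trans (expands n) (f_lip _ _).
  rewrite spoke_dist_tip_pt (_ : 4^-1 = 2^-1 * 2^-1 :> R); last by lra.
  rewrite exprMn mulrA ler_pMl ?exprn_gt0 ?invr_gt0 // exprVn.
  by rewrite ler_pdivlMr ?exprn_gt0 // mul1r.
have k_ge0 : 0 <= k by apply: le_trans (pow2_le 0%N).
have := archi_boundP k_ge0; rewrite ltNge => /negP; apply.
apply: le_trans (pow2_le (Num.bound k)).
by rewrite -natrX ler_nat ltnW // ltn_expl.
Qed.
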